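(* Let $\alpha>1$ be a real number and let $N,s\in\mathbb{N}$. Let $\widetilde{\gamma}_1,\ldots,\widetilde{\gamma}_s$ be nonnegative real numbers and let $\gamma_u=\prod_{j\in u}\widetilde{\gamma}_j$ for $u\subseteq[s]$ (so $\gamma_\emptyset=1$). Assume that $\boldsymbol{g}^\ast=(g_1^\ast,\ldots,g_s^\ast)$ and sets of exclusions $\mathcal{E}_2,\ldots,\mathcal{E}_s\subsetneqq\mathcal{Z}_N$ have been constructed by the component-by-component algorithm with exclusions described in the context. Set $\mathcal{E}_1=\emptyset$. Then for all $1\le d\le s$ and for any $\lambda$ with $1/\alpha<\lambda\le 1$ we have $$e^2(g_1^\ast,\ldots,g_d^\ast)\le\left(\frac{1}{\phi(N)}\sum_{u\subseteq[d]}\gamma_u^\lambda\,(2\zeta(\alpha\lambda))^{|u|}\prod_{j\in u}\frac{\phi(N)}{\phi(N)-|\mathcal{E}_j|}\right)^{1/\lambda},$$ where the product over the empty set is defined as $1$.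
   Context: Notation: $\mathbb{N}$ is the set of positive integers, $[d]=\{1,\ldots,d\}$, $\phi$ is Euler's totient function, $\zeta(\beta)=\sum_{h=1}^\infty h^{-\beta}$ for $\beta>1$, $|\mathcal{E}|$ is the cardinality of a finite set $\mathcal{E}$, and $$\mathcal{Z}_N=\{k\in\{1,2,\ldots,N-1\}:\gcd(k,N)=1\}.$$ Error criterion: given weights $(\gamma_u)_{u\subseteq[s]}$ and $\alpha>1$, for $1\le d\le s$ and $\boldsymbol{h}\in\mathbb{Z}^d\setminus\{\boldsymbol{0}\}$ with support $u=\{j\in[d]:h_j\ne0\}$ put $$r_\alpha(\boldsymbol{\gamma},\boldsymbol{h})=\gamma_u\prod_{j\in u}|h_j|^{-\alpha}.$$ For an integer vector $\boldsymbol{g}=(g_1,\ldots,g_d)$ put $$e^2(\boldsymbol{g})=e^2(g_1,\ldots,g_d)=\sum_{\substack{\boldsymbol{h}\in\mathbb{Z}^d\setminus\{\boldsymbol{0}\}\\ \boldsymbol{g}\cdot\boldsymbol{h}\equiv0\pmod N}}r_\alpha(\boldsymbol{\gamma},\boldsymbol{h}).$$ (For $\boldsymbol{g}\in\mathcal{Z}_N^d$ this is the squared worst-case integration error, in the weighted Korobov space of smoothness $\alpha$ with weights $\boldsymbol{\gamma}$, of the lattice rule with points $(\{ng_1/N\},\ldots,\{ng_d/N\})$, $n=0,\ldots,N-1$.) Component-by-component algorithm with exclusions: given $N,s\in\mathbb{N}$: (i) Set $g_1^\ast=1$. (No exclusions are used in dimension $1$.) (ii) For $d=1,\ldots,s-1$: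 assuming $g_1^\ast,\ldots,g_d^\ast$ have already been found, choose an arbitrary proper subset $\mathcal{E}_{d+1}\subsetneqq\mathcal{Z}_N$ (possibly empty, and allowed to depend on $g_1^\ast,\ldots,g_d^\ast$), and let $g_{d+1}^\ast$ be a minimizer of $g\mapsto e^2(g_1^\ast,\ldots,g_d^\ast,g)$ over $g\in\mathcal{Z}_N\setminus\mathcal{E}_{d+1}$. *)

(* Defs.v *)
From HB Require Import structures.
From mathcomp Require Export all_boot all_order all_algebra.
From mathcomp Require Export all_classical all_reals all_analysis.
Set Implicit Arguments.
Unset Strict Implicit.
Unset Printing Implicit Defensive.
Import Order.TTheory GRing.Theory Num.Theory.
Import numFieldNormedType.Exports.

(* Coordinates are numbered from 0: the ordinal [j : 'I_s] is the coordinate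
   j + 1 of the mathematical text, and [d] = {1, ..., d}, seen inside [s], is
   [initial s d]. *)

Local Open Scope ring_scope.

Definition initial (s d : nat) : {set 'I_s} := [set j : 'I_s | (j < d)%N]%SET.

(* Meaningful for b > 1, where the series converges. *)
Definition zeta {R : realType} (b : R) : R := limn (series (riemannR b)).

Definition Zset (N : nat) : {set 'I_N} :=
  [set k : 'I_N | (0 < k)%N && (gcdn k N == 1%N)]%SET.

Definition product_weights {R : realType} {s : nat} (gt : 'I_s -> R)
  (u : {set 'I_s}) : R := \prod_(j in u) gt j.

(* The support of h in Z^d, d <= s, as a subset of [s]. *)
Definition supp (s d : nat) (ds : (d <= s)%N) (h : 'rV[int]_d) : {set 'I_s} :=
  (widen_ord ds @: [set j : 'I_d | h 0%R j != 0%R])%SET.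

Definition korobov_r {R : realType} (s d : nat) (ds : (d <= s)%N) (a : R)
  (gamma : {set 'I_s} -> R) (h : 'rV[int]_d) : R :=
  gamma (supp ds h) *
  \prod_(j < d | h 0 j != 0) ((`|h 0 j|%:~R : R) `^ (- a)).

(* The sum is an unordered sum with values in [0, +oo]; it has its usual
   meaning for nonnegative weights. *)
Definition e2 {R : realType} (N s d : nat) (ds : (d <= s)%N) (a : R)
  (gamma : {set 'I_s} -> R) (g : 'rV[int]_d) : \bar R :=
  \esum_(h in [set h : 'rV[int]_d |
                h <> 0 /\ (\sum_(j < d) g 0 j * h 0 j = 0 %[mod N%:Z])%Z]%classic)
    (korobov_r ds a gamma h)%:E.

Definition prefix_row (s d : nat) (ds : (d <= s)%N) (g : 'rV[int]_s) :
  'rV[int]_d := \row_(j < d) g 0 (widen_ord ds j).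

Definition rcons_row (d : nat) (g : 'rV[int]_d) (k : int) : 'rV[int]_d.+1 :=
  \row_(j < d.+1) (if unlift ord_max j is Some i then g 0 i else k).

(* (g, E) is an outcome of the component-by-component algorithm with exclusions:
   E at index d (0-based) is the exclusion set used for coordinate d + 1.
   Quantifying over g and E jointly lets every exclusion set depend on the
   coordinates chosen before it; the value of E at index 0 is not used. *)
Definition cbc_with_exclusions {R : realType} (N s : nat) (a : R)
  (gamma : {set 'I_s} -> R) (g : 'rV[int]_s) (E : 'I_s -> {set 'I_N}) : Prop :=
  (forall j : 'I_s, j = 0%N :> nat -> g 0 j = 1) /\
  (forall (d : nat) (d_gt0 : (0 < d)%N) (ds : (d < s)%N),
     let i := Ordinal ds in
     let g_d := prefix_row (ltnW ds) g in
     E i \proper Zset N /\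
     exists k : 'I_N,
       [/\ g 0 i = (k : nat)%:Z,
           k \in (Zset N :\: E i)%SET &
           forall k' : 'I_N, k' \in (Zset N :\: E i)%SET ->
             (e2 N ds a gamma (rcons_row g_d (k : nat)%:Z) <=
              e2 N ds a gamma (rcons_row g_d (k' : nat)%:Z))%E]).

(* Main.v *)
Require Import Defs.
From mathcomp Require Import zify ring lra.
Import Order.TTheory GRing.Theory Num.Theory.
Import numFieldNormedType.Exports.
Local Open Scope ring_scope.

Set Implicit Arguments.
Unset Strict Implicit.
Unset Printing Implicit Defensive.

(** The bound is proved by induction on the dimension, for the squared error
    raised to the power lambda. Write b = alpha lambda > 1.

    The dual vectors of (g, k) split into those with last coordinate zero, which
    contribute e^2(g), and the others, which contribute theta(k)
    ([esum_dual_rcons]). As lambda <= 1, Jensen's inequality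
    ([esum_jensen]) bounds theta(k)^lambda by the sum S(k) of the lambda-powers
    of its terms, and these powers are again Korobov weights, of smoothness b
    and coordinate weights w_j^lambda; hence
    e^2(g, k) <= (e^2(g)^lambda + S(k))^(1/lambda) ([esum_dual_rcons_le]).

    The sum of S(k) over all k in Z_N is at most
    2 zeta(b) w_(d+1)^lambda prod_(j <= d) (1 + 2 zeta(b) w_j^lambda)
    ([sum_esum_dual_ext]). This rests on the fact that for every residue c the
    sum of |m|^-b over k in Z_N and m <> 0 with c + k m = 0 modulo N is at most
    2 zeta(b) ([sum_unit_solutions_le]). As Z_N minus the exclusions E has
    phi(N) - |E| elements, some admissible k has S(k) at most this total divided
    by phi(N) - |E|, and the minimizer is no worse. Since
    phi(N) / (phi(N) - |E_j|) >= 1, the total is at most phi(N) times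
    2 zeta(b) w_(d+1)^lambda B_d, where
    B_d = phi(N)^-1 prod_(j <= d) (1 + 2 zeta(b) w_j^lambda
                                       phi(N) / (phi(N) - |E_j|)),
    so that the bound B_d on e^2(g)^lambda becomes B_(d+1). The first component
    is fixed to be 1, and the multiples of N are sparse enough to give B_1
    directly ([esum_dual_ext_first]). Expanding the product turns B_d into the
    sum over subsets ([sum_product_weights]). *)

(** * Powers of finite and unordered sums *)

Lemma powR_subadditive (R : realType) (x y l : R) :
  0 <= x -> 0 <= y -> 0 < l -> l <= 1 -> (x + y) `^ l <= x `^ l + y `^ l.
Proof.
move=> x0 y0 l0 l1.
have [xy0|xy0] := eqVneq (x + y) 0.
  by rewrite xy0 powR0 ?gt_eqF// addr_ge0 ?powR_ge0.
have s0 : 0 < x + y by rewrite lt_neqAle eq_sym xy0 addr_ge0.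
(* On [0, 1] the l-th power dominates the identity. *)
have frac (z : R) : 0 <= z -> z <= x + y -> z / (x + y) <= (z / (x + y)) `^ l.
  move=> z0 zxy; have [->|zn0] := eqVneq z 0; first by rewrite mul0r powR_ge0.
  have zp : 0 < z by rewrite lt_neqAle eq_sym zn0.
  apply: ger1_powR => //; rewrite divr_gt0//=.
  by rewrite ler_pdivrMr// mul1r.
have -> : x `^ l = (x / (x + y)) `^ l * (x + y) `^ l.
  by rewrite -powRM ?divr_ge0 ?(ltW s0)// divfK.
have -> : y `^ l = (y / (x + y)) `^ l * (x + y) `^ l.
  by rewrite -powRM ?divr_ge0 ?(ltW s0)// divfK.
rewrite -mulrDl -[leLHS]mul1r ler_wpM2r ?powR_ge0//.
rewrite -[leLHS](divff xy0) mulrDl lerD// frac ?lerDl ?lerDr//.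
Qed.

Lemma powR_rootK (R : realType) (x l : R) : 0 <= x -> 0 < l ->
  (x `^ (1 / l)) `^ l = x.
Proof. by move=> x0 l0; rewrite -powRrM mul1r mulVf ?gt_eqF// powRr1. Qed.

Lemma powRK_root (R : realType) (x l : R) : 0 <= x -> 0 < l ->
  (x `^ l) `^ (1 / l) = x.
Proof. by move=> x0 l0; rewrite -powRrM mul1r mulfV ?gt_eqF// powRr1. Qed.

Lemma powR_root_superadditive (R : realType) (x y l : R) :
  0 <= x -> 0 <= y -> 0 < l -> l <= 1 ->
  x `^ (1 / l) + y `^ (1 / l) <= (x + y) `^ (1 / l).
Proof.
move=> x0 y0 l0 l1.
have := powR_subadditive (powR_ge0 x (1 / l)) (powR_ge0 y (1 / l)) l0 l1.
rewrite (powR_rootK x0 l0) (powR_rootK y0 l0) => h.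
have s0 : 0 <= x `^ (1 / l) + y `^ (1 / l) by rewrite addr_ge0 ?powR_ge0.
rewrite -[leLHS](powRK_root s0 l0).
by rewrite ge0_ler_powR// ?nnegrE ?powR_ge0 ?addr_ge0// divr_ge0 ?ltW.
Qed.

Lemma powR_sum_subadditive (R : realType) (I : Type) (r : seq I) (P : pred I)
  (f : I -> R) (l : R) : (forall i, 0 <= f i) -> 0 < l -> l <= 1 ->
  (\sum_(i <- r | P i) f i) `^ l <= \sum_(i <- r | P i) f i `^ l.
Proof.
move=> f0 l0 l1; elim: r => [|i r IH]; first by rewrite !big_nil powR0 ?gt_eqF.
rewrite !big_cons; case: ifP => // _.
by apply: (le_trans (powR_subadditive _ _ l0 l1)); rewrite ?sumr_ge0// lerD2l.
Qed.

Lemma powR_prod (R : realType) (I : Type) (r : seq I) (P : pred I)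
  (f : I -> R) (l : R) : (forall i, 0 <= f i) ->
  (\prod_(i <- r | P i) f i) `^ l = \prod_(i <- r | P i) f i `^ l.
Proof.
move=> f0; elim: r => [|i r IH]; first by rewrite !big_nil powR1.
by rewrite !big_cons; case: ifP => // _; rewrite powRM ?prodr_ge0// IH.
Qed.

(** Jensen's inequality for unordered sums: if the l-th powers of the terms sum
    to at most B, then the terms sum to at most B^(1/l). *)
Lemma esum_jensen (R : realType) (T : choiceType) (S : set T) (f : T -> R)
  (l B : R) : (forall i, 0 <= f i) -> 0 < l -> l <= 1 ->
  (\esum_(i in S) (f i `^ l)%:E <= B%:E)%E ->
  (\esum_(i in S) (f i)%:E <= (B `^ (1 / l))%:E)%E.
Proof.
move=> f0 l0 l1 hB; rewrite ge_ereal_sup// => _ [X [finX XS] <-].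
have : (\sum_(x \in X) (f x `^ l)%:E <= B%:E)%E.
  by apply: le_trans hB; apply: esum_ge; exists X.
rewrite !fsbig_finite//= !sumEFin !lee_fin => hX.
have s0 : 0 <= \sum_(i <- finmap.enum_fset (fset_set X)) f i by exact: sumr_ge0.
rewrite -[leLHS](powRK_root s0 l0).
have h := le_trans (powR_sum_subadditive _ xpredT f0 l0 l1) hX.
by rewrite ge0_ler_powR ?nnegrE ?powR_ge0// ?(le_trans _ h) ?powR_ge0
  ?divr_ge0 ?ltW.
Qed.

Lemma esum_scale_le (R : realType) (T : choiceType) (S : set T) (f : T -> R)
  (c B : R) : 0 <= c -> (\esum_(i in S) (f i)%:E <= B%:E)%E ->
  (\esum_(i in S) (c * f i)%:E <= (c * B)%:E)%E.
Proof.
move=> c0 hB; rewrite ge_ereal_sup// => _ [X [finX XS] <-].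
have : (\sum_(x \in X) (f x)%:E <= B%:E)%E.
  by apply: le_trans hB; apply: esum_ge; exists X.
rewrite !fsbig_finite//= !sumEFin !lee_fin -mulr_sumr => hX.
exact: ler_wpM2l.
Qed.

(** * The zeta series *)

(** A uniform bound on the partial sums S_k of the sum of n^-b: bounding
    the terms 2j and 2j + 1 both by (2j)^-b gives S_(2k+1) <= 1 + 2^(1-b) S_k. *)
Lemma series_riemannR_le (R : realType) (b : R) (n : nat) : 1 < b ->
  series (riemannR b) n <= (1 - 2 `^ (1 - b))^-1.
Proof.
move=> b1.
have q1 : 2 `^ (1 - b) < 1 :> R.
  rewrite /powR pnatr_eq0/= -[ltRHS]expR0 ltr_expR.
  by rewrite pmulr_llt0 ?ln_gt0 ?ltr1n// subr_lt0.
have t0 k : 0 <= riemannR b k by rewrite /riemannR invr_ge0 powR_ge0.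
have SS k : series (riemannR b) k.+1 = series (riemannR b) k + riemannR b k.
  by rewrite /series/= big_nat_recr.
have dbl k : series (riemannR b) k.*2.+1 <=
             1 + 2 `^ (1 - b) * series (riemannR b) k.
  elim: k => [|k IH].
    rewrite SS /series/= big_geq// mulr0 addr0 add0r.
    by rewrite double0 /riemannR powR1 invr1.
  rewrite doubleS (SS k.*2.+2) (SS k.*2.+1) (SS k) -addrA mulrDr (addrA 1).
  rewrite lerD// /riemannR.
  (* 2^(1-b) (k+1)^-b is twice the larger of the two new terms. *)
  have -> : 2 `^ (1 - b) / k.+1%:R `^ b = ((k.*2.+2)%:R `^ b)^-1 *+ 2.
    rewrite (_ : k.*2.+2%:R = 2 * k.+1%:R :> R); last first.
      by rewrite -natrM; congr (_ %:R); lia.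
    rewrite powRM// invfM -mulrnAl; congr (_ * _).
    rewrite powRB ?pnatr_eq0 ?implybT// powRr1// mulr_natl//.
  rewrite mulr2n lerD2l lef_pV2 ?posrE ?powR_gt0 ?ltr0n//.
  by rewrite ge0_ler_powR ?nnegrE// ?ler_nat// ltW// (lt_trans _ b1).
have inc : series (riemannR b) n <= series (riemannR b) n.*2.+1.
  by apply: (nondecreasing_series (P := xpredT)) => //; lia.
have := le_trans inc (dbl n).
set S := series _ _; set q := _ `^ _ => h.
rewrite -[leRHS]mul1r ler_pdivlMr ?subr_gt0//. lra.
Qed.

Lemma esum_zeta (R : realType) (b : R) : 1 < b ->
  \esum_(n in [set: nat]) (riemannR b n)%:E = (zeta b)%:E.
Proof.
move=> b1.
have t0 k : 0 <= riemannR b k by rewrite /riemannR invr_ge0 powR_ge0.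
have cv : cvgn (series (riemannR b)).
  apply: nondecreasing_is_cvgn; first by apply: nondecreasing_series.
  by exists (1 - 2 `^ (1 - b))^-1 => _ [n _ <-]; apply: series_riemannR_le.
rewrite -nneseries_esumT; last by move=> n; rewrite lee_fin.
rewrite /zeta -EFin_lim//; apply: congr_lim; apply/funext => n /=.
by rewrite seriesEnat/= sumEFin.
Qed.

(** * Sums over integers and unit solutions of congruences *)

Lemma esum_nonzero_int (R : realType) (b : R) : 1 < b ->
  \esum_(m in [set m : int | m != 0]%classic) (`|m|%:~R `^ (- b))%:E
  = (2 * zeta b : R)%:E.
Proof.
move=> b1; rewrite (esumID [set m : int | 0 < m]%classic); last first.
  by move=> m _; rewrite lee_fin powR_ge0.
rewrite (reindex_esum setT _ (fun n : nat => Posz n.+1)); last first.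
  split=> [n _|m n _ _ []//|m [/= m0 mp]]; first by split=> /=; lia.
  by exists `|m|.-1%N => //; lia.
rewrite [X in (_ + X)%E](reindex_esum setT _ Negz); last first.
  split=> [n _|m n _ _ []//|m [/= m0 mp]]; first by split=> //=; lia.
  by exists `|m|.-1%N => //; lia.
rewrite mulr_natl mulr2n EFinD -(esum_zeta b1).
by congr (_ + _)%E; apply: eq_esum => n _; rewrite powRN.
Qed.

(** Substituting m = D m' scales the sum by D^(1 - b) <= 1. *)
Lemma esum_multiples_le (R : realType) (b : R) (D : nat) : 1 < b -> (0 < D)%N ->
  (\esum_(m in [set m : int | (m != 0)%R /\ (D%:Z %| m)%Z]%classic)
     (D%:R * `|m|%:~R `^ (- b))%:E
   <= (2 * zeta b : R)%:E)%E.
Proof.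
move=> b1 D0; rewrite -(esum_nonzero_int b1).
rewrite (reindex_esum [set m : int | m != 0]%classic _
           (fun m => D%:Z * m)); last first.
  split=> [m /= m0|m n _ _ /= |m [/= m0 /dvdzP[q mq]]].
  - by split; [rewrite mulf_neq0//; lia|rewrite dvdz_mulr].
  - by apply: mulfI; lia.
  - exists q => /=; last by rewrite mulrC.
    by apply: contra_neq m0 => q0; rewrite mq q0 mul0r.
apply: le_esum => m m0; rewrite lee_fin normrM intrM powRM ?ler0z// mulrA.
rewrite ler_piMl ?powR_ge0// powRN.
rewrite ler_pdivrMr ?powR_gt0 ?ltr0z ?normr_gt0//; last lia.
rewrite mul1r -[leRHS]/(D%:R `^ b) -[leLHS]powRr1//.
by rewrite ler_powR ?ler1n// ltW.
Qed.

(** The k in Z_N with c + k m = 0 modulo N. *)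
Definition unit_solutions (N : nat) (c m : int) : {set 'I_N} :=
  [set k in Zset N | (N%:Z %| c + (k : nat)%:Z * m)%Z]%SET.

(** If k is a unit modulo N and c + k m = 0 modulo N, then gcd (c, N) =
    gcd (m, N) =: D, and k is determined modulo N / D; hence there are at most
    D solutions in [0, N). *)
Lemma card_unit_solutions_le (N : nat) (c m : int) : (0 < N)%N ->
  (#|unit_solutions N c m|
   <= if (gcdn `|c| N %| `|m|)%N then gcdn `|c| N else 0)%N.
Proof.
move=> N0; set S := unit_solutions _ _ _.
have [-> |[k0]] := set_0Vmem S; first by rewrite cards0.
rewrite !inE => /andP[/andP[_ /eqP cop] dvd0].
have gE : gcdn `|c| N = gcdn `|m| N.
  have : gcdz c N = gcdz m N.
    have -> : c = (c + (k0 : nat)%:Z * m) - (k0 : nat)%:Z * m by rewrite addrK.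
    case/dvdzP: dvd0 => q ->.
    rewrite gcdzC -mulrN gcdzMDl mulrN gcdzN Gauss_gcdzr.
      by rewrite gcdzC.
    by rewrite coprimezE coprime_sym /coprime cop.
  by rewrite /gcdz/= => -[].
rewrite gE dvdn_gcdl; set D := gcdn _ N.
have D0 : (0 < D)%N by rewrite gcdn_gt0 N0 orbT.
have DN : (D %| N)%N by exact: dvdn_gcdr.
set M := (N %/ D)%N.
have M0 : (0 < M)%N by rewrite divn_gt0// dvdn_leq.
(* k |-> k / M maps the solutions injectively into [0, D). *)
rewrite cardE -(size_map (fun k : 'I_N => (k %/ M)%N)) -[leqRHS](size_iota 0).
apply: uniq_leq_size.
  rewrite map_inj_in_uniq ?enum_uniq// => k k'.
  rewrite !mem_enum !inE => /andP[_ dk] /andP[_ dk'] ekk'.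
  apply/val_inj => /=; rewrite (divn_eq k M) (divn_eq k' M) ekk'; congr (_ + _)%N.
  apply/eqP; have : (M%:Z %| (k : nat)%:Z - (k' : nat)%:Z)%Z.
    have : (N%:Z %| ((k : nat)%:Z - (k' : nat)%:Z) * m)%Z.
      rewrite (_ : _ * m = (c + (k : nat)%:Z * m) - (c + (k' : nat)%:Z * m));
        last ring.
      exact: rpredB.
    rewrite !dvdzE abszM/= -{1}(divnK DN) -/M.
    have Dm : (D %| `|m|)%N by exact: dvdn_gcdl.
    rewrite -{1}(divnK Dm) mulnA dvdn_pmul2r// Gauss_dvdl//.
    by rewrite /coprime -(eqn_pmul2r D0) muln_gcdl mul1n /M !divnK// gcdnC.
  by rewrite -eqz_mod_dvd !modz_nat.
move=> _ /mapP[k _ ->]; rewrite mem_iota/= add0n ltn_divLR// mulnC.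
by rewrite divnK.
Qed.

(** With D = gcd (c, N), each m that occurs is a multiple of D and occurs for
    at most D values of k, so the double sum is at most the sum of D |m|^-b over
    the nonzero multiples of D, that is, D^(1 - b) 2 zeta(b) <= 2 zeta(b). *)
Lemma sum_unit_solutions_le (R : realType) (b : R) (N : nat) (c : int) (C : R) :
  1 < b -> (0 < N)%N -> 0 <= C ->
  (\sum_(k in Zset N)
     \esum_(m in [set m : int | (m != 0)%R /\
                   (N%:Z %| (c + (k : nat)%:Z * m)%R)%Z]%classic)
       (C * `|m|%:~R `^ (- b))%:E
   <= (C * (2 * zeta b) : R)%:E)%E.
Proof.
move=> b1 N0 C0; pose f (m : int) : R := C * `|m|%:~R `^ (- b).
have f0 m : 0 <= f m by rewrite mulr_ge0 ?powR_ge0.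
pose D := gcdn `|c| N.
have D0 : (0 < D)%N by rewrite gcdn_gt0 N0 orbT.
apply: (le_trans _ (esum_scale_le C0 (esum_multiples_le b1 D0))).
under eq_bigr => k _ do rewrite esum_mkcond.
rewrite -esum_sum; last by move=> m k _ _; case: ifP => // _; exact: f0.
rewrite [leRHS]esum_mkcond; apply: le_esum => m _.
have [->|m0] := eqVneq m 0.
  rewrite big1 => [|k _]; last by rewrite memNset// => -[/eqP].
  by rewrite memNset// => -[/eqP].
rewrite (eq_bigr (fun k : 'I_N => if k \in unit_solutions N c m
                                  then (f m)%:E else 0%E)); last first.
  move=> k kZ; rewrite /unit_solutions finset.in_set kZ/=.
  have [dk|dk] := boolP (N%:Z %| c + (k : nat)%:Z * m)%Z.
    by rewrite mem_set.
  by rewrite memNset//= => -[_]; exact/negP.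
rewrite -big_mkcondr/= (eq_bigl (mem (unit_solutions N c m))); last first.
  by move=> k; apply/andb_idl; rewrite finset.in_set => /andP[].
rewrite sumEFin sumr_const.
have := card_unit_solutions_le c m N0; rewrite -/D.
case: ifPn => Dm cardle.
  rewrite mem_set//.
  rewrite lee_fin mulrCA mulr_natl; exact: ler_wpMn2l.
move: cardle; rewrite leqn0 => /eqP ->; rewrite mulr0n; case: ifP => // _.
by rewrite lee_fin mulr_ge0// mulr_ge0// powR_ge0.
Qed.

(** * Korobov weights as products over the coordinates *)

(** The contribution of one coordinate of weight w and frequency m to the
    Korobov weight of smoothness b; it is 1 at m = 0. *)
Definition korobov_factor (R : realType) (b w : R) (m : int) : R :=
  if m == 0 then 1 else w * `|m|%:~R `^ (- b).

(** The Korobov weight of a frequency vector for product weights. The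
    coordinate weights are indexed by nat, so that one family serves all the
    dimensions. *)
Definition korobov_prod (R : realType) (b : R) (w : nat -> R) (d : nat)
  (h : 'rV[int]_d) : R := \prod_(j < d) korobov_factor b (w j) (h 0 j).

Lemma korobov_factor_ge0 (R : realType) (b w : R) (m : int) :
  0 <= w -> 0 <= korobov_factor b w m.
Proof.
by move=> w0; rewrite /korobov_factor; case: ifP => // _; rewrite mulr_ge0 ?powR_ge0.
Qed.

Lemma korobov_prod_ge0 (R : realType) (b : R) (w : nat -> R) (d : nat)
  (h : 'rV[int]_d) : (forall j, 0 <= w j) -> 0 <= korobov_prod b w h.
Proof. by move=> w0; apply: prodr_ge0 => j _; exact: korobov_factor_ge0. Qed.

Lemma korobov_factor_powR (R : realType) (b w l : R) (m : int) : 0 <= w ->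
  korobov_factor b w m `^ l = korobov_factor (b * l) (w `^ l) m.
Proof.
move=> w0; rewrite /korobov_factor; case: ifP => _; first by rewrite powR1.
by rewrite powRM ?powR_ge0// -powRrM mulNr.
Qed.

(** Raising to the power l keeps the Korobov form: the smoothness b becomes
    b * l and each coordinate weight is raised to the power l. *)
Lemma korobov_prod_powR (R : realType) (b l : R) (w : nat -> R) (d : nat)
  (h : 'rV[int]_d) : (forall j, 0 <= w j) ->
  korobov_prod b w h `^ l = korobov_prod (b * l) (fun j => w j `^ l) h.
Proof.
move=> w0; rewrite /korobov_prod.
rewrite powR_prod => [|j]; last exact: korobov_factor_ge0.
by apply: eq_bigr => j _; rewrite korobov_factor_powR.
Qed.

(** * Adding one coordinate *)

Lemma rcons_row_widen (d : nat) (g : 'rV[int]_d) (k : int) (j : 'I_d) :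
  rcons_row g k 0 (widen_ord (leqnSn d) j) = g 0 j.
Proof.
rewrite mxE (_ : widen_ord _ j = lift ord_max j) ?liftK//.
by apply: val_inj; rewrite /= /bump leqNgt ltn_ord.
Qed.

Lemma rcons_row_max (d : nat) (g : 'rV[int]_d) (k : int) :
  rcons_row g k 0 ord_max = k.
Proof. by rewrite mxE unlift_none. Qed.

Lemma rcons_row_bij (d : nat) (Q : set 'rV[int]_d.+1) :
  set_bij [set hm : 'rV[int]_d * int | Q (rcons_row hm.1 hm.2)]%classic Q
    (fun hm => rcons_row hm.1 hm.2).
Proof.
split=> [hm //|[h m] [h' m'] _ _ /= e|h Qh].
  congr (_, _); last by rewrite -(rcons_row_max h m) e rcons_row_max.
  by apply/rowP => j; rewrite -(rcons_row_widen h m) e rcons_row_widen.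
suff hE : rcons_row (\row_j h 0 (widen_ord (leqnSn d) j)) (h 0 ord_max) = h.
  by exists (\row_j h 0 (widen_ord (leqnSn d) j), h 0 ord_max); rewrite /= hE.
apply/rowP => j; rewrite mxE; case: unliftP => [i ->|->//].
by rewrite mxE; congr (h 0 _); apply: val_inj; rewrite /= /bump leqNgt ltn_ord.
Qed.

Lemma rcons_row_eq0 (d : nat) (h : 'rV[int]_d) (m : int) :
  rcons_row h m = 0 <-> h = 0 /\ m = 0.
Proof.
split=> [e|[-> ->]]; last first.
  by apply/rowP => j; rewrite !mxE; case: unlift => // i; rewrite mxE.
split; last by rewrite -(rcons_row_max h m) e mxE.
by apply/rowP => j; rewrite -(rcons_row_widen h m) e !mxE.
Qed.

Lemma korobov_prod_rcons (R : realType) (b : R) (w : nat -> R) (d : nat)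
  (h : 'rV[int]_d) (m : int) :
  korobov_prod b w (rcons_row h m) =
  korobov_prod b w h * korobov_factor b (w d) m.
Proof.
rewrite /korobov_prod big_ord_recr/= rcons_row_max; congr (_ * _).
by apply: eq_bigr => j _; rewrite rcons_row_widen.
Qed.

(** The inner product of two integer vectors. *)
Definition dot (d : nat) (g h : 'rV[int]_d) : int :=
  \sum_(j < d) g 0 j * h 0 j.

Lemma dot_rcons (d : nat) (g h : 'rV[int]_d) (k m : int) :
  dot (rcons_row g k) (rcons_row h m) = dot g h + k * m.
Proof.
rewrite /dot big_ord_recr/= !rcons_row_max; congr (_ + _).
by apply: eq_bigr => j _; rewrite !rcons_row_widen.
Qed.

Lemma esum_korobov_factor (R : realType) (b w : R) : 1 < b -> 0 <= w ->
  (\esum_(m in [set: int]) (korobov_factor b w m)%:E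
   <= (1 + w * (2 * zeta b) : R)%:E)%E.
Proof.
move=> b1 w0; rewrite (esumID [set 0]%classic); last first.
  by move=> m _; exact: korobov_factor_ge0.
rewrite !setTI esum_set1; last by rewrite lee_fin korobov_factor_ge0.
rewrite {1}/korobov_factor eqxx EFinD leeD2l//.
have nz : (\esum_(m in [set m : int | (m != 0)%R]%classic) (`|m|%:~R `^ (- b))%:E
            <= (2 * zeta b : R)%:E)%E by rewrite esum_nonzero_int.
apply: (le_trans _ (esum_scale_le w0 nz)).
rewrite le_eqVlt; apply/orP; left; apply/eqP.
rewrite (_ : [set m : int | _]%classic = [set~ 0]%classic); last first.
  by apply/seteqP; split=> m /= /eqP.
by apply: eq_esum => m /eqP/negbTE m0; rewrite /korobov_factor m0.
Qed.

Lemma esum_korobov_prod (R : realType) (b : R) (w : nat -> R) (d : nat) :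
  1 < b -> (forall j, 0 <= w j) ->
  (\esum_(h in [set: 'rV[int]_d]) (korobov_prod b w h)%:E
   <= (\prod_(j < d) (1 + w j * (2 * zeta b)) : R)%:E)%E.
Proof.
move=> b1 w0; elim: d => [|d IH].
  rewrite (_ : setT = [set 0]%classic); last first.
    by apply/seteqP; split=> // h _ /=; apply/rowP => -[].
  by rewrite esum_set1 /korobov_prod !big_ord0.
rewrite (reindex_esum _ _ _ _ (rcons_row_bij _)) big_ord_recr/= mulrC.
set z := 1 + _ * _.
have z0 : 0 <= z.
  have := esum_korobov_factor b1 (w0 d); rewrite -lee_fin; apply: le_trans.
  by apply: esum_ge0 => m _; rewrite lee_fin korobov_factor_ge0.
rewrite (_ : [set _ | _]%classic = (setT `*`` (fun=> setT))%classic); last first.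
  by apply/seteqP; split.
under eq_esum => hm _ do rewrite korobov_prod_rcons.
rewrite -(esum_esum (a := fun h m =>
  (korobov_prod b w h * korobov_factor b (w d) m)%:E)); last first.
  by move=> h m _ _; rewrite lee_fin mulr_ge0 ?korobov_prod_ge0 ?korobov_factor_ge0.
apply: (le_trans _ (esum_scale_le z0 IH)); apply: le_esum => h _.
rewrite [z * _]mulrC; apply: esum_scale_le; first exact: korobov_prod_ge0.
exact: esum_korobov_factor.
Qed.

(** The nonzero vectors of the dual lattice of g modulo N. *)
Definition dual_set (N d : nat) (g : 'rV[int]_d) : set 'rV[int]_d :=
  [set h : 'rV[int]_d |
     h <> 0 /\ (N%:Z %| dot g h)%Z]%classic.

(** The vectors of the dual lattice of (g, k) whose last coordinate is nonzero,
    as pairs (h, m) of the first d coordinates and the last one; h may be 0. *)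
Definition dual_ext (N d : nat) (g : 'rV[int]_d) (k : int) :
  set ('rV[int]_d * int) :=
  [set hm : 'rV[int]_d * int | hm.2 != 0 /\
     (N%:Z %| dot g hm.1 + k * hm.2)%Z]%classic.

(** The dual vectors of (g, k) whose last coordinate is 0 are the dual vectors
    of g. *)
Lemma esum_dual_rcons (R : realType) (N d : nat) (g : 'rV[int]_d) (k : int)
  (b : R) (w : nat -> R) : (forall j, 0 <= w j) ->
  (\esum_(h in dual_set N (rcons_row g k)) (korobov_prod b w h)%:E =
   \esum_(h in dual_set N g) (korobov_prod b w h)%:E +
   \esum_(hm in dual_ext N g k)
      (korobov_prod b w hm.1 * korobov_factor b (w d) hm.2)%:E)%E.
Proof.
move=> w0; rewrite (reindex_esum _ _ _ _ (rcons_row_bij _)).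
under eq_esum => hm _ do rewrite korobov_prod_rcons.
rewrite (esumID [set hm | hm.2 = 0]%classic); last first.
  by move=> hm _; rewrite lee_fin mulr_ge0 ?korobov_prod_ge0 ?korobov_factor_ge0.
congr (_ + _)%E; last first.
  congr (esum _ _); apply/seteqP; split=> -[h m] /=.
    by case=> -[_]; rewrite dot_rcons => dv /eqP.
  case=> m0 dv; split; last exact/eqP.
  by split; [move=> /rcons_row_eq0[_ /eqP]; rewrite (negbTE m0)|rewrite dot_rcons].
rewrite (reindex_esum (dual_set N g) _ (fun h => (h, 0))).
  by apply: eq_esum => h _; rewrite /korobov_factor eqxx mulr1.
split=> [h [h0 dv]|h h' _ _ []//|[h m] [/= [h0 dv] m0]].
  by split=> //=; split; [move=> /rcons_row_eq0[]|rewrite dot_rcons mulr0 addr0].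
subst m; exists h => //; split; first by move=> hE; apply: h0; apply/rcons_row_eq0.
by move: dv; rewrite dot_rcons mulr0 addr0.
Qed.

(** The averaging bound. For each h, the sum over k and m is at most
    2 zeta(b) w_d times the weight of h by [sum_unit_solutions_le], whatever the
    residue of g . h; the weights of all h are summed by [esum_korobov_prod]. *)
Lemma sum_esum_dual_ext (R : realType) (N d : nat) (g : 'rV[int]_d)
  (b : R) (w : nat -> R) : 1 < b -> (0 < N)%N -> (forall j, 0 <= w j) ->
  (\sum_(k in Zset N) \esum_(hm in dual_ext N g (k : nat)%:Z)
      (korobov_prod b w hm.1 * korobov_factor b (w d) hm.2)%:E <=
   (w d * (2 * zeta b) * \prod_(j < d) (1 + w j * (2 * zeta b)) : R)%:E)%E.
Proof.
move=> b1 N0 w0.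
pose J (k : 'I_N) (h : 'rV[int]_d) := [set m : int | m != 0 /\
  (N%:Z %| dot g h + (k : nat)%:Z * m)%Z]%classic.
have term_ge0 h m : (0 <= (korobov_prod b w h * korobov_factor b (w d) m)%:E)%E.
  by rewrite lee_fin mulr_ge0 ?korobov_prod_ge0 ?korobov_factor_ge0.
rewrite (eq_bigr (fun k : 'I_N => \esum_(h in setT) \esum_(m in J k h)
   (korobov_prod b w h * korobov_factor b (w d) m)%:E)%E); last first.
  move=> k _; rewrite esum_esum//; congr (esum _ _).
  by apply/seteqP; split=> -[h m] /=; [split|case].
rewrite -esum_sum; last by move=> h k _ _; exact: esum_ge0.
have z0 : 0 <= 2 * zeta b.
  rewrite -lee_fin -esum_nonzero_int//.
  by apply: esum_ge0 => m _; rewrite lee_fin powR_ge0.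
apply: (le_trans _ (esum_scale_le _ (esum_korobov_prod d b1 w0))); last first.
  exact: mulr_ge0.
apply: le_esum => h _.
have C0 : 0 <= korobov_prod b w h * w d by rewrite mulr_ge0// korobov_prod_ge0.
rewrite (_ : w d * _ * _ = korobov_prod b w h * w d * (2 * zeta b)); last ring.
apply: le_trans (sum_unit_solutions_le (dot g h) b1 N0 C0).
apply: lee_sum => k _; rewrite le_eqVlt; apply/orP; left; apply/eqP.
apply: eq_esum => m [m0 _].
by rewrite /korobov_factor (negbTE m0) mulrA.
Qed.

(** * The error of product weights and the averaging argument *)

(** The extension to nat, by the default value x0, of a family indexed by
    ['I_s]. *)
Definition extend (T : Type) (s : nat) (x0 : T) (f : 'I_s -> T) (j : nat) : T :=
  if insub j is Some i then f i else x0.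

Lemma extend_ord (T : Type) (s : nat) (x0 : T) (f : 'I_s -> T) (i : 'I_s) :
  extend x0 f i = f i.
Proof. by rewrite /extend valK. Qed.

Lemma korobov_r_product (R : realType) (s d : nat) (ds : (d <= s)%N) (a : R)
  (gt : 'I_s -> R) (h : 'rV[int]_d) :
  korobov_r ds a (product_weights gt) h = korobov_prod a (extend 0 gt) h.
Proof.
rewrite /korobov_r /product_weights /supp big_imset/=; last first.
  by move=> i j _ _ /(congr1 val) /= e; apply: val_inj.
rewrite (eq_bigl (fun j => h 0 j != 0)); last by move=> j; rewrite finset.in_set.
rewrite -big_split/= big_mkcond/=; apply: eq_bigr => j _.
rewrite /korobov_factor; case: eqP => //= _.
by rewrite -(extend_ord 0 gt (widen_ord ds j)).
Qed.

Lemma e2_product (R : realType) (N s d : nat) (ds : (d <= s)%N) (a : R)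
  (gt : 'I_s -> R) (g : 'rV[int]_d) :
  e2 N ds a (product_weights gt) g =
  \esum_(h in dual_set N g) (korobov_prod a (extend 0 gt) h)%:E.
Proof.
rewrite /e2 (_ : mkset _ = dual_set N g); last first.
  apply/seteqP; split=> h /= [h0 dv]; split=> //.
    by apply/dvdz_mod0P; rewrite dv mod0z.
  by rewrite mod0z; apply/dvdz_mod0P.
by apply: eq_esum => h _; rewrite korobov_r_product.
Qed.

Lemma prefix_row_rcons (s d : nat) (ds : (d < s)%N) (g : 'rV[int]_s) :
  prefix_row ds g = rcons_row (prefix_row (ltnW ds) g) (g 0 (Ordinal ds)).
Proof.
apply/rowP => j; rewrite !mxE; case: unliftP => [i ->|->].
  by rewrite mxE; congr (g 0 _); apply: val_inj; rewrite /= /bump leqNgt ltn_ord.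
by congr (g 0 _); apply: val_inj.
Qed.

Lemma totient_leq (N : nat) : (totient N <= N)%N.
Proof.
rewrite totient_count_coprime big_mkord.
by rewrite -[leqRHS]card_ord -sum1_card leq_sum// => i _; case: coprime.
Qed.

Lemma card_Zset (N : nat) : (1 < N)%N -> #|Zset N| = totient N.
Proof.
move=> N1; rewrite totient_count_coprime big_mkord -sum1_card big_mkcond/=.
apply: eq_bigr => k _; rewrite finset.in_set coprime_sym /coprime.
by case: posnP => [->|]//=; rewrite ?gcd0n; case: eqP => //; lia.
Qed.

(** One step of the construction: if e^2(g) <= B^(1/l), and if the new terms,
    each raised to the power l, sum to at most S, then
    e^2(g, k) <= (B + S)^(1/l). *)
Lemma esum_dual_rcons_le (R : realType) (N d : nat) (g : 'rV[int]_d) (k : int)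
  (a l : R) (w : nat -> R) (B S : R) : 0 < l -> l <= 1 -> (forall j, 0 <= w j) ->
  0 <= B -> 0 <= S ->
  (\esum_(h in dual_set N g) (korobov_prod a w h)%:E <= (B `^ (1 / l))%:E)%E ->
  (\esum_(hm in dual_ext N g k)
     (korobov_prod (a * l) (fun j => w j `^ l) hm.1 *
      korobov_factor (a * l) (w d `^ l) hm.2)%:E <= S%:E)%E ->
  (\esum_(h in dual_set N (rcons_row g k)) (korobov_prod a w h)%:E
   <= ((B + S) `^ (1 / l))%:E)%E.
Proof.
move=> l0 l1 w0 B0 S0 hB hS; rewrite esum_dual_rcons//.
apply: (@le_trans _ _ (B `^ (1 / l) + S `^ (1 / l))%:E); last first.
  by rewrite lee_fin powR_root_superadditive.
rewrite EFinD leeD//; apply: esum_jensen => // [hm|].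
  by rewrite mulr_ge0 ?korobov_prod_ge0 ?korobov_factor_ge0.
apply: le_trans hS; apply: le_esum => hm _.
by rewrite powRM ?korobov_prod_ge0 ?korobov_factor_ge0// korobov_prod_powR//
  korobov_factor_powR.
Qed.

(** Extended real values are allowed in f; the bound on the sum over Z forces
    them to be finite on Z. *)
Lemma exists_le_average (R : realType) (I : finType) (A Z : {set I})
  (f : I -> \bar R) (C : R) : A != finset.set0 -> A \subset Z ->
  (forall i, 0 <= f i)%E -> (\sum_(i in Z) f i <= C%:E)%E ->
  exists2 i, i \in A & (f i <= (C / #|A|%:R)%:E)%E.
Proof.
move=> A0 AZ f0 hC.
have fC i : i \in Z -> (f i <= C%:E)%E.
  move=> iZ; apply: le_trans hC; rewrite (bigD1 i)//= leeDl//.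
  exact: sume_ge0.
have ffin i : i \in Z -> f i \is a fin_num.
  by move=> iZ; rewrite ge0_fin_numE// (le_lt_trans (fC _ iZ)) ?ltry.
have [i0 i0A] := set0Pn _ A0.
have [i iA imin] := arg_minP (fun i => fine (f i)) i0A.
exists i => //; have iZ := fintype.subsetP AZ _ iA.
rewrite -(fineK (ffin _ iZ)) lee_fin ler_pdivlMr ?ltr0n ?card_gt0//.
rewrite mulr_natr -sumr_const -lee_fin; apply: le_trans hC.
rewrite [leRHS](finset.big_setID A)/= (finset.setIidPr AZ) -sumEFin.
rewrite -[leLHS]adde0 leeD//; last exact: sume_ge0.
apply: lee_sum => j jA; rewrite -[leRHS]fineK ?ffin ?(fintype.subsetP AZ)//.
by rewrite lee_fin imin.
Qed.

Lemma sum_product_weights (R : realType) (s d : nat) (ds : (d <= s)%N)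
  (gt x : 'I_s -> R) (l z : R) : (forall j, 0 <= gt j) ->
  \sum_(u : {set 'I_s} | u \subset initial s d)
    (product_weights gt u `^ l * z ^+ #|u| * \prod_(j in u) x j) =
  \prod_(j < d) (1 + extend 0 gt j `^ l * z * extend 0 x j).
Proof.
move=> gt0; pose f j := extend 0 gt j `^ l * z * extend 0 x j.
rewrite (big_ord_widen s (fun j => 1 + f j) ds) [RHS]big_mkcond/=.
transitivity (\prod_(i < s) ((if (i < d)%N then f i else 0) + 1)); last first.
  by apply: eq_bigr => i _; case: ifP; rewrite ?add0r// addrC.
rewrite bigA_distr [LHS]big_mkcond/=; apply: eq_bigr => u _.
rewrite -big_mkcond/=; case: ifPn => [/fintype.subsetP ud|].
  rewrite powR_prod// -prodr_const -!big_split/=; apply: eq_bigr => j ju.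
  by have := ud _ ju; rewrite finset.in_set /f !extend_ord => ->.
case/subsetPn => j ju; rewrite finset.in_set => /negbTE jd.
by rewrite (bigD1 j)//= jd mul0r.
Qed.

(** The new terms in dimension 1, where the component is 1 and the dual lattice
    consists of the multiples of N. *)
Lemma esum_dual_ext_first (R : realType) (N : nat) (g : 'rV[int]_0)
  (b : R) (w : nat -> R) : 1 < b -> (0 < N)%N -> (forall j, 0 <= w j) ->
  (\esum_(hm in dual_ext N g 1)
     (korobov_prod b w hm.1 * korobov_factor b (w 0%N) hm.2)%:E
   <= (w 0%N / N%:R * (2 * zeta b))%:E)%E.
Proof.
move=> b1 N0 w0.
have c0 : 0 <= w 0%N / N%:R by rewrite divr_ge0.
apply: le_trans (esum_scale_le c0 (esum_multiples_le b1 N0)).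
rewrite (reindex_esum [set m : int | m != 0 /\ (N%:Z %| m)%Z]%classic _
          (fun m => (0 : 'rV[int]_0, m))); last first.
  split=> [m [m0 dv]|m m' _ _ []//|[h m] [m0 dv]] /=.
    by split=> //=; rewrite /dot big_ord0 add0r mul1r.
  exists m; first by split=> //; move: dv; rewrite /dot big_ord0 add0r mul1r.
  by congr (_, _); apply/rowP => -[].
apply: le_esum => m [m0 _]; rewrite lee_fin.
rewrite /korobov_prod big_ord0 mul1r /korobov_factor (negbTE m0) mulrA divfK//.
by rewrite pnatr_eq0 -lt0n.
Qed.

(** * The error bound *)

Theorem theorem1 (R : realType) (alpha : R) (alpha_gt1 : 1 < alpha)
  (N s : nat) (N_gt0 : (0 < N)%N) (s_gt0 : (0 < s)%N)
  (gt : 'I_s -> R) (gt_ge0 : forall j : 'I_s, 0 <= gt j)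
  (g : 'rV[int]_s) (E : 'I_s -> {set 'I_N})
  (cbc : cbc_with_exclusions alpha (product_weights gt) g E)
  (E1 : forall j : 'I_s, j = 0%N :> nat -> E j = finset.set0)
  (d : nat) (d_gt0 : (0 < d)%N) (ds : (d <= s)%N)
  (lambda : R) (lambda_gt : 1 / alpha < lambda) (lambda_le1 : lambda <= 1) :
  (e2 N ds alpha (product_weights gt) (prefix_row ds g) <=
   ((1 / (totient N)%:R *
     \sum_(u : {set 'I_s} | u \subset initial s d)
        (product_weights gt u `^ lambda *
         (2 * zeta (alpha * lambda)) ^+ #|u| *
         \prod_(j in u) ((totient N)%:R / ((totient N)%:R - #|E j|%:R))))
    `^ (1 / lambda))%:E)%E.
Proof.
have a0 : 0 < alpha by exact: lt_trans alpha_gt1.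
have l0 : 0 < lambda by apply: le_lt_trans lambda_gt; rewrite divr_ge0 ?ltW.
have b1 : 1 < alpha * lambda by rewrite mulrC -ltr_pdivrMr.
have [g1 gE] := cbc.
pose phi : R := (totient N)%:R.
have phi0 : 0 < phi by rewrite ltr0n totient_gt0.
pose z : R := 2 * zeta (alpha * lambda).
have z0 : 0 <= z.
  rewrite -lee_fin -esum_nonzero_int//.
  by apply: esum_ge0 => m _; rewrite lee_fin powR_ge0.
pose w := extend 0 gt.
have w0 j : 0 <= w j by rewrite /w /extend; case: insub.
have wl0 j : 0 <= w j `^ lambda by exact: powR_ge0.
have wz0 j : 0 <= w j `^ lambda * z by exact: mulr_ge0.
have cardE j (js : (0 < j)%N) (jS : (j < s)%N) :
    (#|E (Ordinal jS)| < totient N)%N.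
  have [EZ _] := gE j js jS.
  have N1 : (1 < N)%N.
    have /properP[_ [k + _]] := EZ; rewrite finset.in_set => /andP[k0 _].
    exact: leq_ltn_trans k0 (ltn_ord k).
  by rewrite -(card_Zset N1); exact: proper_card.
pose x := extend 0 (fun j => phi / (phi - #|E j|%:R)).
(* The exclusions leave at least one candidate, so the factor is at least 1. *)
have x1 j : (j < s)%N -> 1 <= x j.
  move=> jS; rewrite -[j]/(val (Ordinal jS)) /x extend_ord.
  have lt : (#|E (Ordinal jS)| < totient N)%N.
    case: (posnP j) => [j0|j0]; last exact: cardE.
    by rewrite E1// cards0 totient_gt0.
  by rewrite ler_pdivlMr ?subr_gt0 ?ltr_nat// mul1r gerBl.
rewrite (sum_product_weights ds) // -/w -/phi -/x -/z.
(* (B n)^(1/lambda) is the claimed bound in dimension n, with the sum over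
   subsets in product form. The induction starts in dimension 0, where the dual
   set is empty. *)
pose B n := 1 / phi * \prod_(j < n) (1 + w j `^ lambda * z * x j).
rewrite -/(B d).
(* The left-hand side bounds the sum of the lambda-powers of the weights over
   all frequency vectors of dimension n. *)
have prod_le n : (n <= s)%N ->
    \prod_(j < n) (1 + w j `^ lambda * z) <= phi * B n.
  move=> ns; rewrite /B mulrA div1r mulfV ?gt_eqF// mul1r.
  apply: ler_prod => j _; apply/andP; split.
    by rewrite addr_ge0.
  rewrite lerD2l.
  by rewrite -[leLHS]mulr1 ler_wpM2l// x1// (leq_trans _ ns).
have prod1 n : 0 <= \prod_(j < n) (1 + w j `^ lambda * z).
  by apply: prodr_ge0 => j _; rewrite addr_ge0.
have B0 n : (n <= s)%N -> 0 <= B n.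
  move=> ns; rewrite -(pmulr_rge0 _ phi0).
  exact: le_trans (prod_le n ns).
have BS n : B n.+1 = B n + B n * (w n `^ lambda * z * x n).
  by rewrite /B big_ord_recr/= mulrA mulrDr mulr1.
clear d_gt0; elim: d ds => [|d IH] ds.
  rewrite e2_product esum1 ?lee_fin ?powR_ge0// => h [h0 _].
  by case: h0; apply/rowP => -[].
have inc0 : 0 <= B d * (w d `^ lambda * z * x d).
  rewrite mulr_ge0 ?B0 ?(ltnW ds)// mulr_ge0//.
  exact: le_trans (x1 _ ds).
have {IH} := IH (ltnW ds); rewrite !e2_product -/w => IH.
rewrite BS; case: (posnP d) => [d0|d0].
  (* The first component is 1 and involves no minimization; N^-1 <= phi^-1
     replaces the averaging. *)
  subst d; rewrite prefix_row_rcons g1//.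
  apply: esum_dual_rcons_le => //; first exact: B0.
  apply: le_trans (esum_dual_ext_first _ b1 N_gt0 wl0) _.
  rewrite lee_fin /B big_ord0 mulr1 div1r -/z mulrAC [leRHS]mulrC.
  have iN : N%:R^-1 <= phi^-1 :> R.
    by rewrite lef_pV2 ?posrE ?ltr0n ?totient_gt0// ler_nat totient_leq.
  apply: ler_pM => //; rewrite ?invr_ge0//.
  by rewrite -[leLHS]mulr1 ler_wpM2l// x1.
have [EZ [k [gk kA kmin]]] := gE d d0 ds.
have := sum_esum_dual_ext (prefix_row (ltnW ds) g) b1 N_gt0 wl0.
rewrite -/z => sumle.
have A0 : (Zset N :\: E (Ordinal ds) != finset.set0)%SET.
  by apply/set0Pn; exists k.
have S_ge0 (i : 'I_N) : (0 <=
  \esum_(hm in dual_ext N (prefix_row (ltnW ds) g) (i : nat)%:Z)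
    (korobov_prod (alpha * lambda) (fun j => w j `^ lambda) hm.1 *
     korobov_factor (alpha * lambda) (w d `^ lambda) hm.2)%:E)%E.
  apply: esum_ge0 => hm _.
  by rewrite lee_fin mulr_ge0 ?korobov_prod_ge0 ?korobov_factor_ge0.
(* The minimizer k does at least as well as the candidate k', for which
   the lambda-powers of the new terms sum to at most the average over the
   admissible components. *)
have [k' k'A k'le] := exists_le_average A0 (finset.subsetDl _ _) S_ge0 sumle.
rewrite prefix_row_rcons gk -/w.
have := kmin _ k'A; rewrite !e2_product -/w => /le_trans; apply.
apply: (esum_dual_rcons_le l0 lambda_le1 w0 (B0 _ (ltnW ds)) inc0 IH).
apply: le_trans k'le _; rewrite lee_fin.
have N1 : (1 < N)%N.
  move: kA; rewrite finset.in_setD finset.in_set => /and3P[_ k0 _].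
  exact: leq_ltn_trans k0 (ltn_ord k).
have -> : #|(Zset N :\: E (Ordinal ds))%SET|%:R = phi - #|E (Ordinal ds)|%:R.
  rewrite cardsDS; last exact: proper_sub EZ.
  by rewrite card_Zset// natrB// ltnW// cardE.
rewrite -[d in x d]/(val (Ordinal ds)) /x extend_ord.
have dl : 0 < phi - #|E (Ordinal ds)|%:R by rewrite subr_gt0 ltr_nat cardE.
rewrite (_ : B d * _ = w d `^ lambda * z * (phi * B d) /
                       (phi - #|E (Ordinal ds)|%:R)); last ring.
by rewrite ler_wpM2r ?invr_ge0 ?(ltW dl)// ler_wpM2l// prod_le// ltnW.
Qed.
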